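(* Let $m\ge1$, $\varepsilon\in\{0,1\}$ with $2m+\varepsilon\ge3$, let $m+1\le n\le 2m+\varepsilon+1$, and let $Z^\varepsilon_{m,n}$ be the smooth projective toric $(2m+\varepsilon)$-fold defined in the context, with $\mathrm{Pic}(Z^\varepsilon_{m,n})$ identified with $\mathbb Z^{n+1}$ by the coordinates $(q_1,\dots,q_n;A)$ defined there. A class $(q_1,\dots,q_n;A)$ is nef if and only if $$q_i\ge0\quad(1\le i\le n),$$ $$\sum_{i\in I}q_i\le A\quad\text{for all } I\subset\{1,\dots,n\},\ |I|=m,$$ $$A\le\sum_{j\in J}q_j\quad\text{for all } J\subset\{1,\dots,n\},\ |J|=m+1.$$ Moreover, $$-K_{Z^\varepsilon_{m,n}}=(2,\dots,2;\,2m+\varepsilon+1).$$ For fixed $m\ge2$ and $m+1\le n\le2m+1$, the models $Z^0_{m,n}$ and $Z^1_{m,n}$ have the same nef semigroup under these coordinates, while their anticanonical classes differ.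
   Context: All toric varieties are over an algebraically closed field. A primitive collection of a smooth complete fan is a set of primitive ray generators that does not span a cone although every proper subset does; a set of ray generators spans a cone iff it contains no primitive collection. The models $Z^\varepsilon_{m,n}$. Let $d=2m+\varepsilon\ge3$. Let $N\simeq\mathbb Z^d$ and $x_1,\dots,x_{d+1}\in N$ with $x_1,\dots,x_d$ a basis and $x_1+\cdots+x_{d+1}=0$; put $y_i=-x_i$ for $1\le i\le n$. $Z^\varepsilon_{m,n}$ is the smooth projective toric $d$-fold whose fan has primitive ray generators $x_1,\dots,x_{d+1},y_1,\dots,y_n$ and whose primitive collections are exactly the left-hand sides of the following primitive relations: $x_i+y_i=0$ ($1\le i\le n$); $\sum_{j\notin I}x_j=\sum_{i\in I}y_i$ for $I\subset\{1,\dots,n\}$, $|I|=m$; $\sum_{j\in J}y_j=\sum_{\ell\notin J}x_\ell$ for $J\subset\{1,\dots,n\}$, $|J|=m+1$; complements being taken in $\{1,\dots,2m+\varepsilon+1\}$. Coordinates. For an invariant divisor $D=\sum_{j=1}^{2m+\varepsilon+1}a_jD_{x_j}+\sum_{i=1}^nb_iD_{y_i}$ put $q_i=a_i+b_i$ ($1\le i\le n$) and $A=\sum_{j=1}^{2m+\varepsilon+1}a_j$. The assignment $[D]\mapsto(q_1,\dots,q_n;A)$ is an isomorphism $\mathrm{Pic}(Z^\varepsilon_{m,n})\simeq\mathbb Z^{n+1}$. The nef semigroup is $\mathrm{Nef}(Z^\varepsilon_{m,n})\cap\mathrm{Pic}(Z^\varepsilon_{m,n})$. *)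

(* Defs.v *)
From HB Require Import structures.
From mathcomp Require Import all_boot all_order all_algebra.
From mathcomp Require Import boolp classical_sets functions cardinality fsbigop.

Set Implicit Arguments.
Unset Strict Implicit.
Unset Printing Implicit Defensive.

Import Order.TTheory GRing.Theory Num.Theory.
Local Open Scope ring_scope.

(** * Smooth toric varieties through their fans

    The lattice is N = Z^d; [gen] gives the primitive ray generators and
    [cones] the sets of rays that span a cone. The notions below are the usual
    ones for the toric variety X of the fan when the fan is smooth and
    complete; the record does not carry those axioms. *)

Record fan_data (d : nat) := FanData {
  ray : finType;
  gen : ray -> 'rV[int]_d;
  cones : {set {set ray}}
}.

Definition primitive_collection d (F : fan_data d) (P : {set ray F}) : bool :=
  (P \notin cones F) && [forall Q : {set ray F}, (Q \proper P) ==> (Q \in cones F)].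

(** Torus-invariant divisors: [D r] is the coefficient of the prime divisor of
    the ray [r]. *)
Definition divisor d (F : fan_data d) := {ffun ray F -> int}.

Definition pairing d (u w : 'rV[int]_d) : int := \sum_i u 0 i * w 0 i.

Definition div_char d (F : fan_data d) (u : 'rV[int]_d) : divisor F :=
  [ffun r => pairing u (gen r)].

Definition lin_equiv d (F : fan_data d) (D D' : divisor F) : Prop :=
  exists u, D' = D + div_char F u.

(** The divisor of the invariant rational form dχ_1/χ_1 ∧ ... ∧ dχ_d/χ_d, which
    has a simple pole along every invariant prime divisor and no other zero or
    pole. *)
Definition canonical_divisor d (F : fan_data d) : divisor F := [ffun=> - 1].

(** * Complete nonsingular curves over k

    A complete nonsingular curve C over an algebraically closed field k is
    given by its function field K; its points are the normalized discrete
    valuations of K that are trivial on k. *)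

Section Curve.
Variables (k K : fieldType) (iota : {rmorphism k -> K}).

(** K is a finite extension of k(t), with t transcendental over k. *)
Definition function_field : Prop :=
  exists t : K,
    (forall p : {poly k}, (map_poly iota p).[t] = 0 -> p = 0) /\
    exists (s : nat) (b : 'I_s -> K), forall x : K,
      exists (q : {poly k}) (p : 'I_s -> {poly k}),
        q != 0 /\
        (map_poly iota q).[t] * x = \sum_(i < s) (map_poly iota (p i)).[t] * b i.

(** [v 0 = 0] is a junk value, which makes the function [v] determined by the
    point of C that it represents. *)
Definition place (v : K -> int) : Prop :=
  [/\ v 0 = 0 /\ (forall c : k, v (iota c) = 0),
      (forall x y, x != 0 -> y != 0 -> v (x * y) = v x + v y),
      (forall x y, x != 0 -> y != 0 -> x + y != 0 ->
         Num.min (v x) (v y) <= v (x + y))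
    & exists x, v x = 1].

Variables (d : nat) (F : fan_data d).

(** Morphisms f : C -> X in Cox's homogeneous coordinates: f is given by
    line bundles L_r with sections x_r (r a ray), with trivializations of
    the products of the L_r^<u,r> for all characters u, such that at every
    point of C the rays r whose section vanishes span a cone. Here L_r = O(E_r)
    with E_r = sum_v (e v r) v, the sections x_r are elements of K, and
    [v (x r) + e v r] is the order of vanishing of x_r, as a section of L_r, at
    the point v. After rescaling the x_r by elements of K^* (and changing the
    E_r accordingly), the trivializations become the equalities
    sum_r <u,r> E_r = 0. *)
Definition curve_map (x : ray F -> K) (e : (K -> int) -> ray F -> int) : Prop :=
  [set r | x r == 0] \in cones F /\
  forall v, place v ->
    [/\ \sum_r e v r *: gen r = 0,
        (forall r, x r != 0 -> 0 <= v (x r) + e v r)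
      & [set r | (x r == 0) || (0 < v (x r) + e v r)] \in cones F].

(** D.f_*C = z: replace D by a linearly equivalent D' whose support does not
    contain f(C), and take the degree of the pulled back divisor f^*D'. The
    result does not depend on D'. *)
Definition intersection_number (D : divisor F)
    (x : ray F -> K) (e : (K -> int) -> ray F -> int) (z : int) : Prop :=
  exists D' : divisor F,
    [/\ lin_equiv D D',
        (forall r, x r = 0 -> D' r = 0)
      & z = \sum_(v \in (place : set (K -> int)))
              \sum_(r | x r != 0) D' r * (v (x r) + e v r)].

End Curve.

(** Every irreducible complete curve in X is the image of its normalization;
    constant maps are not excluded, but they have intersection number 0. *)
Definition nef (k : closedFieldType) d (F : fan_data d) (D : divisor F) : Prop :=
  forall (K : fieldType) (iota : {rmorphism k -> K}), function_field iota ->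
  forall (x : ray F -> K) (e : (K -> int) -> ray F -> int), curve_map iota x e ->
  exists2 z : int, intersection_number iota D x e z & 0 <= z.

(** * The models Z^eps_{m,n}

    Indices are shifted to start from 0: [inl j] with j : 'I_(d.+1) stands for
    x_{j+1}, and [inr i] with i : 'I_n for y_{i+1}. *)

Definition xvec d (j : 'I_d.+1) : 'rV[int]_d :=
  if unlift ord_max j is Some i then delta_mx 0 i else const_mx (- 1).

Section Model.
Variables (m eps n : nat).
Let d := (2 * m + eps)%N.

(** The index i as an index of the x's; meaningful when n <= d + 1. *)
Definition xidx (i : 'I_n) : 'I_d.+1 := inord i.

Definition Zgen (r : 'I_d.+1 + 'I_n) : 'rV[int]_d :=
  match r with inl j => xvec j | inr i => - xvec (xidx i) end.

Definition Zprim : {set {set 'I_d.+1 + 'I_n}} :=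
  [set [set inl (xidx i); inr i] | i : 'I_n]
  :|: [set inl @: (~: (xidx @: I)) | I : {set 'I_n} & #|I| == m]
  :|: [set inr @: J | J : {set 'I_n} & #|J| == m.+1].

Definition Z : fan_data d :=
  @FanData d ('I_d.+1 + 'I_n)%type Zgen
    [set C : {set 'I_d.+1 + 'I_n} | [forall P in Zprim, ~~ (P \subset C)]].

(** The coordinates (q_1, ..., q_n; A). *)
Definition coords (D : divisor Z) : 'rV[int]_n * int :=
  (\row_i (D (inl (xidx i)) + D (inr i)), \sum_(j < d.+1) D (inl j)).

(** The image in Z^{n+1} of the semigroup of nef classes. *)
Definition nef_semigroup (k : closedFieldType) : set ('rV[int]_n * int) :=
  [set c | exists2 D : divisor Z, nef k D & coords D = c]%classic.

Lemma sum_xvec : \sum_(j < d.+1) xvec j = 0.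
Proof.
have wlift j : widen_ord (leqnSn d) j = lift ord_max j.
  by apply/val_inj; rewrite /= /bump leqNgt ltn_ord.
rewrite big_ord_recr /= /xvec unlift_none.
apply/rowP=> i; rewrite !mxE summxE (bigD1 i) //= big1 => [|j ji].
  by rewrite wlift liftK mxE !eqxx addr0 subrr.
by rewrite wlift liftK mxE eqxx eq_sym (negPf ji).
Qed.

Lemma pairing_delta (u : 'rV[int]_d) (i : 'I_d) :
  pairing u (xvec (lift ord_max i)) = u 0 i.
Proof.
rewrite /pairing /xvec liftK (bigD1 i) //= big1 => [|j ji].
  by rewrite mxE !eqxx mulr1 addr0.
by rewrite mxE eqxx (negPf ji) mulr0.
Qed.

Lemma sum_pairing_xvec (u : 'rV[int]_d) : \sum_(j < d.+1) pairing u (xvec j) = 0.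
Proof.
rewrite /pairing exchange_big big1 //= => i _.
have /rowP/(_ i) := sum_xvec; rewrite summxE mxE => E.
by rewrite -mulr_sumr E mulr0.
Qed.

Lemma pairingN (u w : 'rV[int]_d) : pairing u (- w) = - pairing u w.
Proof. by rewrite /pairing -sumrN; apply: eq_bigr => i _; rewrite mxE mulrN. Qed.

(** [coords] identifies the Picard group of invariant divisors modulo linear
    equivalence with Z^{n+1}. *)
Lemma coordsD (D D' : divisor Z) :
  coords (D + D') = ((coords D).1 + (coords D').1, (coords D).2 + (coords D').2).
Proof.
congr pair; first by apply/rowP=> i; rewrite !mxE !ffunE addrACA.
by rewrite /= -big_split; apply: eq_bigr => j _; rewrite ffunE.
Qed.

Lemma coords_eq (D D' : divisor Z) : lin_equiv D D' <-> coords D = coords D'.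
Proof.
split=> [[u ->]|].
  congr pair.
    by apply/rowP=> i; rewrite !mxE !ffunE /= pairingN addrACA subrr addr0.
  rewrite -[LHS]addr0 -[X in _ + X](sum_pairing_xvec u) -big_split.
  by apply: eq_bigr => j _; rewrite !ffunE.
case=> /rowP eqq eqA.
pose u : 'rV[int]_d := \row_i (D' (inl (lift ord_max i)) - D (inl (lift ord_max i))).
have lft j : D' (inl (lift ord_max j)) =
    D (inl (lift ord_max j)) + pairing u (xvec (lift ord_max j)).
  by rewrite pairing_delta mxE addrC subrK.
have eqx j : D' (inl j) = D (inl j) + pairing u (xvec j).
  case: (unliftP ord_max j) => [i|] -> //.
  have: \sum_j (D' (inl j) - D (inl j) - pairing u (xvec j)) = 0.
    by rewrite !sumrB sum_pairing_xvec eqA subrr subr0.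
  rewrite (bigD1 ord_max) //= big1 => [|l].
    by rewrite addr0 -addrA -opprD => /eqP; rewrite subr_eq0 => /eqP.
  case: (unliftP ord_max l) => [i ->|->]; last by rewrite eqxx.
  by rewrite lft => _; rewrite addrAC addrK subrr.
exists u; apply/ffunP=> -[j|i]; rewrite !ffunE /= ?eqx //.
have := eqq i; rewrite !mxE eqx pairingN -addrA => /addrI ->.
by rewrite addrC addrK.
Qed.

Lemma coords_surj c : exists D : divisor Z, coords D = c.
Proof.
case: c => q A.
pose ax (j : 'I_d.+1) : int := if j == ord0 then A else 0.
exists [ffun r : 'I_d.+1 + 'I_n =>
  match r with inl j => ax j | inr i => q 0 i - ax (xidx i) end].
congr pair; first by apply/rowP=> i; rewrite mxE !ffunE addrC subrK.
rewrite (bigD1 ord0) //= big1 => [|j /negPf j0]; rewrite ffunE /ax ?j0 //.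
by rewrite eqxx addr0.
Qed.

Lemma Zprim_card P : (0 < m)%N -> (n <= d.+1)%N -> P \in Zprim -> (1 < #|P|)%N.
Proof.
move=> m0 nd; have xinj : injective xidx.
  move=> i j /(congr1 val); rewrite /= !inordK; first exact: val_inj.
    exact: leq_trans (ltn_ord _) nd.
  exact: leq_trans (ltn_ord _) nd.
rewrite !inE => /orP[/orP[]|] /imsetP[I]; rewrite ?inE.
- by move=> _ ->; rewrite cards2.
- move=> /eqP cI ->; rewrite card_imset; last by move=> ? ? [].
  have := cardsC (xidx @: I); rewrite card_imset // cI card_ord /d => E.
  rewrite -(ltn_add2l m) E addn1 ltnS mul2n -addnn -addnA.
  by rewrite -[X in (X < _)%N]addn0 ltn_add2l addn_gt0 m0.
- by move=> /eqP cI ->; rewrite card_imset ?cI //; move=> ? ? [].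
Qed.

Lemma Zprim_antichain P Q :
  (0 < m)%N -> (n <= d.+1)%N -> P \in Zprim -> Q \in Zprim -> ~~ (P \proper Q).
Proof.
move=> m0 nd hP hQ; apply/negP=> PQ.
have cP := Zprim_card m0 nd hP; have ltPQ := proper_card PQ.
have xinj : injective xidx.
  move=> i j /(congr1 val); rewrite /= !inordK; first exact: val_inj.
    exact: leq_trans (ltn_ord _) nd.
  exact: leq_trans (ltn_ord _) nd.
have cl (I : {set 'I_n}) : #|(inl @: (~: (xidx @: I)) : {set 'I_d.+1 + 'I_n})|
    = (d.+1 - #|I|)%N.
  rewrite card_imset; last by move=> ? ? [].
  by rewrite cardsCs finset.setCK card_ord card_imset.
have cr (I : {set 'I_n}) : #|(inr @: I : {set 'I_d.+1 + 'I_n})| = #|I|.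
  by rewrite card_imset //; move=> ? ? [].
have [z zP] : exists z, z \in P by apply/card_gt0P; exact: ltnW.
have sPQ := fintype.subsetP (proper_sub PQ).
move: hQ; rewrite !inE => /orP[/orP[]|] /imsetP[I]; rewrite ?inE.
- by move=> _ EQ; move: ltPQ; rewrite EQ cards2 /= ltnS leqNgt cP.
- move=> /eqP cI EQ.
  have nor i : inr i \notin P.
    by apply/negP=> /sPQ; rewrite EQ => /imsetP[].
  move: hP; rewrite !inE => /orP[/orP[]|] /imsetP[J]; rewrite ?inE.
  + by move=> _ EP; move: (nor J); rewrite EP !inE eqxx orbT.
  + by move=> /eqP cJ EP; move: ltPQ; rewrite EP EQ !cl cI cJ ltnn.
  + move=> _ EP; move: zP (nor); rewrite EP => /imsetP[i iJ _] /(_ i).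
    by rewrite imset_f.
- move=> /eqP cI EQ.
  have nol i : inl i \notin P.
    by apply/negP=> /sPQ; rewrite EQ => /imsetP[].
  move: hP; rewrite !inE => /orP[/orP[]|] /imsetP[J]; rewrite ?inE.
  + by move=> _ EP; move: (nol (xidx J)); rewrite EP !inE eqxx.
  + move=> _ EP; move: zP (nol); rewrite EP => /imsetP[i iJ _] /(_ i).
    by rewrite imset_f.
  + by move=> /eqP cJ EP; move: ltPQ; rewrite EP EQ !cr cI cJ ltnn.
Qed.

Lemma primitive_collectionZ (P : {set ray Z}) :
  (0 < m)%N -> (n <= d.+1)%N -> primitive_collection P = (P \in Zprim).
Proof.
move=> m0 nd; apply/idP/idP.
  case/andP; rewrite inE => /forall_inPn[Q hQ]; rewrite negbK => sQP.
  move=> /forallP/(_ Q)/implyP; move: sQP; rewrite finset.subEproper.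
  case/predU1P=> [<- //|pQP] /(_ pQP); rewrite inE => /forall_inP/(_ Q hQ).
  by rewrite subxx.
move=> hP; apply/andP; split.
  by rewrite inE; apply/forall_inPn; exists P => //; rewrite negbK.
apply/forallP=> Q; apply/implyP=> QP; rewrite inE; apply/forall_inP=> R hR.
apply/negP=> RQ; have := Zprim_antichain m0 nd hR hP.
by rewrite (sub_proper_trans RQ QP).
Qed.

End Model.

Arguments nef_semigroup m eps n k : clear implicits.

(* Main.v *)
Require Import Defs.
From mathcomp Require Import boolp classical_sets fsbigop.
From mathcomp Require Import all_boot all_order all_algebra.
From mathcomp Require Import zify generic_quotient fraction.

(** The nef inequalities say that D has nonnegative degree on the primitive
    relations. These relations are the classes of explicit rational curves, and
    they are enough to make D base point free.

    If D is nef, let a relation be given between rays, of the form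
    (sum of the rays of P) = (combination of the rays of R), such that R
    together with any proper subset of P spans a cone. Then there is an explicit
    map from the projective line to X: the coordinates of the rays of R vanish
    identically, those of the rays of P are X - c_r with c_r equal to 0 or 1,
    and the others are constant ([curve_map_curve_section]). Its degree against
    D is the value of D on the relation ([intersection_number_curve]), which is
    therefore nonnegative ([nef_ray_relation]). Here the
    function field is the fraction field of k[X], and all that is needed about
    its places is that X - c, seen as a section of the line bundle of the point
    at infinity, vanishes at exactly one place, to the first order
    ([place_zero_of_XsubC]). The three families of primitive relations of the
    model satisfy the hypothesis on cones, and give the three families of
    inequalities ([nef_q_ge0], [nef_le_A], [nef_A_le]).

    Conversely, the inequalities make D base point free in the toric sense: for
    every cone C, D is linearly equivalent to an effective divisor that does not
    involve the rays of C ([effective_off_cone]). In the coordinates (q; A) this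
    asks for integers a_j with sum A in prescribed intervals, and the
    inequalities compare A with the sums of the two ends. Given a curve, take C
    to be the set of the coordinates that vanish on it: the local contributions
    to the degree are then all nonnegative ([base_point_free_nef]), so that
    nothing has to be known about the places of an arbitrary function field.

    Since the inequalities do not involve eps while the last coordinate of the
    anticanonical class does, the comparison of the two models follows. *)

Set Implicit Arguments.
Unset Strict Implicit.
Unset Printing Implicit Defensive.

Import Order.TTheory GRing.Theory Num.Theory.
Local Open Scope ring_scope.

(** * Places of the field of rational functions *)

Lemma mup_add (k : fieldType) c (p q : {poly k}) : p != 0 -> q != 0 -> p + q != 0 ->
  (minn (mup c p) (mup c q) <= mup c (p + q))%N.
Proof.
move=> p0 q0 pq0; rewrite mup_geq // dvdp_add // -mup_geq //.
  exact: geq_minl.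
exact: geq_minr.
Qed.

(** The two hypotheses on F characterize the fraction field of k[X]. *)
Section FractionField.
Variables (k K : fieldType) (F : {rmorphism {poly k} -> K}).
Hypothesis F_eq0 : forall p, (F p == 0) = (p == 0).
Hypothesis F_frac : forall f, exists p q, q != 0 /\ f = F p / F q.

Definition ratfun_const : {rmorphism k -> K} :=
  (F \o polyC : {rmorphism k -> K}).

Local Notation iota := ratfun_const.
Local Notation t := (F 'X).

Lemma horner_ratfun_var (p : {poly k}) : (map_poly iota p).[t] = F p.
Proof.
elim/poly_ind: p => [|p c IH]; first by rewrite rmorph0 horner0 rmorph0.
by rewrite !rmorphD !rmorphM /= map_polyX map_polyC hornerMXaddC IH.
Qed.

Lemma ratfun_function_field : function_field iota.
Proof.
exists t; split=> [p|].
  by rewrite horner_ratfun_var => /eqP; rewrite F_eq0 => /eqP.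
exists 1%N, (fun=> 1) => f; have [p [q [q0 ->]]] := F_frac f.
exists q, (fun=> p); split=> //.
by rewrite big_ord1 mulr1 !horner_ratfun_var mulrC divfK ?F_eq0.
Qed.

Lemma F_neq0 p : p != 0 -> F p != 0. Proof. by rewrite F_eq0. Qed.

Lemma ratfun_neq0P (f : K) : f != 0 ->
  exists p q : {poly k}, [/\ p != 0, q != 0 & f = F p / F q].
Proof.
have [p [q [q0 ->]]] := F_frac f; move=> f0; exists p, q; split=> //.
by apply: contraNneq f0 => ->; rewrite rmorph0 mul0r.
Qed.

(** The set contains exactly one integer if f is nonzero; it is empty for
    f = 0, and the default value 0 is then the one required of a place. *)
Definition order_at (c : k) (f : K) : int :=
  xget 0 [set n | exists p q : {poly k}, [/\ p != 0, q != 0, f = F p / F q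
                    & n = (mup c p)%:Z - (mup c q)%:Z]]%classic.

Lemma order_at0 c : order_at c 0 = 0.
Proof.
rewrite /order_at; case: xgetP => // n _ [p [q [p0 q0 /eqP]]].
by rewrite eq_sym mulf_eq0 invr_eq0 !F_eq0 (negPf p0) (negPf q0).
Qed.

Lemma order_at_frac c (p q : {poly k}) : p != 0 -> q != 0 ->
  order_at c (F p / F q) = (mup c p)%:Z - (mup c q)%:Z.
Proof.
move=> p0 q0; rewrite /order_at.
case: xgetP => [n _ [p' [q' [p'0 q'0 E ->]]]|].
  have {E} : p * q' = p' * q.
    apply/eqP; rewrite -subr_eq0 -F_eq0 rmorphB !rmorphM subr_eq0.
    by rewrite -eqr_div ?F_neq0 // E.
  move/(congr1 (mup c)); rewrite !mupM //.
  move: (mup c p) (mup c q) (mup c p') (mup c q') => *; lia.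
by move/(_ ((mup c p)%:Z - (mup c q)%:Z)); case; exists p, q.
Qed.

Lemma order_at_poly c (p : {poly k}) : p != 0 ->
  order_at c (F p) = (mup c p)%:Z.
Proof.
move=> p0; rewrite -[F p]divr1 -(rmorph1 F) order_at_frac ?oner_eq0 //.
by rewrite (@mupNroot _ _ 1) ?root1 // subr0.
Qed.

Lemma order_at_XsubC c : order_at c (F ('X - c%:P)) = 1.
Proof.
rewrite order_at_poly ?polyXsubC_eq0 //.
by rewrite -['X - _]expr1 mup_XsubCX eqxx.
Qed.

Lemma place_order_at c : place iota (order_at c).
Proof.
split.
- split=> [|a]; first by rewrite order_at0.
  have [->|a0] := eqVneq a 0; first by rewrite rmorph0 order_at0.
  rewrite /= order_at_poly ?polyC_eq0 // mupNroot //.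
  by rewrite rootC.
- move=> _ _ /ratfun_neq0P[p [q [p0 q0 ->]]] /ratfun_neq0P[p' [q' [p'0 q'0 ->]]].
  rewrite mulf_div -!rmorphM !order_at_frac ?mulf_neq0 // !mupM //.
  by rewrite !PoszD opprD addrACA.
- move=> _ _ /ratfun_neq0P[p [q [p0 q0 ->]]] /ratfun_neq0P[p' [q' [p'0 q'0 ->]]].
  rewrite addf_div ?F_neq0 // -!rmorphM -rmorphD => s0.
  have {}s0 : p * q' + p' * q != 0.
    by apply: contraNneq s0 => ->; rewrite rmorph0 mul0r.
  rewrite !order_at_frac ?mulf_neq0 //.
  have := mup_add c (mulf_neq0 p0 q'0) (mulf_neq0 p'0 q0) s0.
  rewrite !mupM // ge_min.
  move: (mup c p) (mup c q) (mup c p') (mup c q') (mup c (_ + _)) => *; lia.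
- by exists (F ('X - c%:P)); exact: order_at_XsubC.
Qed.

Section Place.
Variables (v : K -> int).
Hypothesis vP : place iota v.

Lemma place_const a : v (iota a) = 0. Proof. by case: vP => -[]. Qed.

(** The bound n <= 0 allows x, y and x + y to be zero, where a place takes the
    value 0. *)
Lemma place_addr_ge n x y : n <= 0 -> n <= v x -> n <= v y -> n <= v (x + y).
Proof.
case: vP => -[v0 _] _ vD _ n0 nx ny.
have [->|x0] := eqVneq x 0; first by rewrite add0r.
have [->|y0] := eqVneq y 0; first by rewrite addr0.
have [->|xy0] := eqVneq (x + y) 0; first by rewrite v0.
by apply: le_trans (vD _ _ x0 y0 xy0); rewrite le_min nx.
Qed.

Lemma place_mul_ge0 x y : 0 <= v x -> 0 <= v y -> 0 <= v (x * y).
Proof.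
case: vP => -[v0 _] vM _ _ hx hy.
have [->|x0] := eqVneq x 0; first by rewrite mul0r v0.
have [->|y0] := eqVneq y 0; first by rewrite mulr0 v0.
by rewrite vM // addr_ge0.
Qed.

Lemma place_poly_ge0 p : 0 <= v t -> 0 <= v (F p).
Proof.
move=> vt; elim/poly_ind: p => [|p c IH]; first by rewrite rmorph0; case: vP => -[->].
rewrite rmorphD rmorphM place_addr_ge ?place_mul_ge0 //.
by rewrite (place_const c).
Qed.

Lemma place_var_ge0 c : 0 <= v (F ('X - c%:P)) -> 0 <= v t.
Proof.
move=> h; rewrite -['X](subrK c%:P) rmorphD place_addr_ge //.
by rewrite (place_const c).
Qed.

(** The polynomials lie in the valuation ring of v, and X - c in its maximal
    ideal. If q were in the maximal ideal too, then so would be the nonzero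
    constant q.[c], which is q minus a multiple of X - c. *)
Lemma place_nonroot c (q : {poly k}) :
  0 < v (F ('X - c%:P)) -> q.[c] != 0 -> v (F q) = 0.
Proof.
move=> vc qc; have vt := place_var_ge0 (ltW vc).
have q0 : q != 0 by apply: contraNneq qc => ->; rewrite horner0.
apply: le_anti; rewrite place_poly_ge0 // andbT leNgt; apply/negP=> vq.
have /factor_theorem[q' E] : root (q - q.[c]%:P) c.
  by rewrite rootE !hornerE subrr.
case: vP => -[v0 _] vM vD _.
have vqc : v (iota q.[c]) = 0 by exact: place_const.
have E' : iota q.[c] = (F q) + (- (F q')) * (F ('X - c%:P)).
  by rewrite mulNr -rmorphM -E rmorphB opprB addrC subrK.
have [q'0|q'0] := eqVneq q' 0.
  by move: vq; rewrite -[q](subrK q.[c]%:P) E q'0 mul0r add0r vqc ltxx.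
have tc0 : F ('X - c%:P) != 0 by rewrite F_eq0 polyXsubC_eq0.
have := vD (F q) (- (F q') * (F ('X - c%:P))).
rewrite -E' vqc => /(_ (F_neq0 q0)).
have m0 : - F q' * F ('X - c%:P) != 0.
  by rewrite mulf_neq0 // oppr_eq0 F_neq0.
have iq0 : iota q.[c] != 0 by rewrite F_neq0 ?polyC_eq0.
move=> /(_ m0 iq0); rewrite leNgt => /negP; apply.
rewrite lt_min vq vM // ?oppr_eq0 ?(F_neq0 q'0) //=.
by rewrite ltr_wpDl // -rmorphN place_poly_ge0.
Qed.

Lemma place_poly c (p : {poly k}) : 0 < v (F ('X - c%:P)) -> p != 0 ->
  v (F p) = (mup c p)%:Z * v (F ('X - c%:P)).
Proof.
move=> vc p0; have [m [q]] := multiplicity_XsubC p c; rewrite p0 /= => qc E.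
case: vP => _ vM _ _.
have tc0 : F ('X - c%:P) != 0 by rewrite F_eq0 polyXsubC_eq0.
have vX n : v ((F ('X - c%:P)) ^+ n) = n%:Z * v (F ('X - c%:P)).
  elim: n => [|n IH]; first by rewrite expr0 mul0r -(rmorph1 iota) place_const.
  by rewrite exprS vM ?expf_neq0 // IH intS mulrDl mul1r.
have q0 : q != 0 by apply: contraNneq p0 => q0; rewrite E q0 mul0r.
rewrite E mupMr // mup_XsubCX eqxx rmorphM rmorphXn vM ?expf_neq0 ?(F_neq0 q0) //.
by rewrite (place_nonroot vc) // add0r vX.
Qed.

(** On polynomials, hence on fractions, v is the order at c times the value of
    v at X - c; this value divides 1 because v is normalized. *)
Lemma place_eq_order_at c : 0 < v (F ('X - c%:P)) -> v = order_at c.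
Proof.
move=> vc; case: (vP) => -[v0 _] vM _ [g vg].
have vE f : v f = order_at c f * v (F ('X - c%:P)).
  have [->|f0] := eqVneq f 0; first by rewrite v0 order_at0 mul0r.
  have [p [q [p0 q0 fE]]] := ratfun_neq0P f0.
  have fq : f * F q = F p by rewrite fE divfK ?F_neq0.
  have := vM f (F q) f0 (F_neq0 q0).
  rewrite fq (place_poly vc p0) (place_poly vc q0) => /eqP.
  by rewrite -subr_eq fE order_at_frac // mulrBl => /eqP <-.
have v1 : v (F ('X - c%:P)) = 1.
  move: vg vc; rewrite (vE g); move: (order_at c g) (v _) => a b.
  by have [|] := lerP a 0; nia.
by apply/funext=> f; rewrite vE v1 mulr1.
Qed.

(** [Num.max 0 (- v (F 'X))] is the multiplicity of v in the divisor of poles of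
    X - c, which is the point at infinity for every c. The left-hand side is
    therefore the order of vanishing of X - c as a section of the line bundle of
    that point. *)
Lemma place_zero_of_XsubC c :
  v (F ('X - c%:P)) + Num.max 0 (- v t) = (v == order_at c)%:R.
Proof.
have [->|nv] := eqVneq v (order_at c).
  rewrite order_at_XsubC max_l ?addr0 // oppr_le0.
  by rewrite order_at_poly ?polyX_eq0.
have vc : v (- iota c) = 0 by rewrite -rmorphN place_const.
rewrite rmorphB; have [vt|vt] := leP 0 (v t).
  rewrite max_l ?oppr_le0 // addr0; apply: le_anti.
  rewrite place_addr_ge ?vc // andbT leNgt -rmorphB.
  by apply/negP=> /place_eq_order_at /eqP; rewrite (negPf nv).
rewrite max_r ?oppr_ge0 ?ltW //; apply/eqP; rewrite subr_eq0; apply/eqP.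
apply: le_anti; rewrite place_addr_ge ?vc ?(ltW vt) // andbT leNgt; apply/negP=> h.
(* X = (X - c) + c, so its order is at least that of X - c or at least 0. *)
suff : Num.min 0 (v (t - iota c)) <= v t by rewrite leNgt lt_min vt h.
rewrite -{2}['X](subrK c%:P) rmorphD rmorphB place_addr_ge ?place_const //.
- by rewrite ge_min lexx.
- by rewrite ge_min lexx orbT.
- by rewrite ge_min lexx.
Qed.

End Place.
End FractionField.

(** * Rational curves from relations between rays *)

Lemma pairing_sum d (I : Type) (s : seq I) (Q : pred I) (c : I -> int)
    (w : I -> 'rV[int]_d) (u : 'rV[int]_d) :
  pairing u (\sum_(i <- s | Q i) c i *: w i) =
  \sum_(i <- s | Q i) c i * pairing u (w i).
Proof.
rewrite /pairing; under [RHS]eq_bigr do rewrite mulr_sumr.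
rewrite exchange_big; apply: eq_bigr => j _.
by rewrite summxE mulr_sumr; apply: eq_bigr => i _; rewrite mxE mulrCA.
Qed.

(** The degree of a sum of points f i times pt i, some of which may
    coincide. *)
Lemma fsum_indicator (T : choiceType) (A : set T) (I : finType) (Q : pred I)
    (f : I -> int) (pt : I -> T) : (forall i, A (pt i)) ->
  \sum_(v \in A) \sum_(i | Q i) f i * (v == pt i)%:R = \sum_(i | Q i) f i.
Proof.
move=> ptA; rewrite (@fsbigE _ _ _ _ _ (undup (codom pt))).
- rewrite exchange_big; apply: eq_bigr => i _; rewrite big_mkcond /=.
  rewrite (bigD1_seq (pt i)) ?undup_uniq ?mem_undup ?codom_f //=.
  rewrite mem_set // eqxx mulr1 big1 ?addr0 // => v /negPf ->.
  by rewrite mulr0 if_same.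
- exact: undup_uniq.
- by move=> v /=; rewrite mem_undup => /codomP[i ->].
- move=> v _; rewrite mem_undup => vpt; apply: big1 => i _.
  by case: eqP vpt => [->|]; rewrite ?codom_f // mulr0.
Qed.

(** The curve attached to a relation between rays. The line bundle of a ray is
    the point at infinity times the coefficient of the ray in the relation, so
    that the relation gives the trivializations pointwise. *)
Section RationalCurve.
Variables (k K : fieldType) (F : {rmorphism {poly k} -> K}).
Hypothesis F_eq0 : forall p, (F p == 0) = (p == 0).
Hypothesis F_frac : forall f, exists p q, q != 0 /\ f = F p / F q.
Local Notation iota := (ratfun_const F).

Variables (d : nat) (X : fan_data d) (P R : {set ray X}) (c : ray X -> int).
Hypothesis relPR : \sum_(r in P) gen r = \sum_(r in R) c r *: gen r.
Hypothesis conesPR : forall S : {set ray X}, S \proper P -> R :|: S \in cones X.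
Variables r0 r1 : ray X.
Hypothesis r0P : r0 \in P.
Hypothesis r1P : r1 \in P.
Hypothesis r10 : r1 != r0.

(** Two points of the line are enough: r0 is sent to 0 and r1 to 1, so the rays
    of P are not all sent to the same point. *)
Definition zero_of (r : ray X) : k := (r != r0)%:R.

Definition curve_section (r : ray X) : K :=
  if r \in R then 0 else if r \in P then F ('X - (zero_of r)%:P) else 1.

Definition curve_twist (v : K -> int) (r : ray X) : int :=
  Num.max 0 (- v (F 'X)) * ((r \in P)%:R - (r \in R)%:R * c r).

Lemma curve_section_eq0 r : (curve_section r == 0) = (r \in R).
Proof.
rewrite /curve_section; case: ifP => _; first by rewrite eqxx.
by case: ifP => _; rewrite ?oner_eq0 // F_eq0 polyXsubC_eq0.
Qed.

Lemma curve_vanishing v r : place iota v -> r \notin R ->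
  v (curve_section r) + curve_twist v r =
  ((r \in P) && (v == order_at F (zero_of r)))%:R.
Proof.
move=> vP rR; rewrite /curve_section /curve_twist (negPf rR) mul0r subr0.
case: ifP => rP; last first.
  by rewrite mulr0 addr0 -(rmorph1 iota) (place_const vP).
by rewrite mulr1 (place_zero_of_XsubC F_eq0 F_frac).
Qed.

Lemma order_at_01 : order_at F 0 != order_at F 1.
Proof.
apply/eqP=> /(congr1 (@^~ (F 'X))); have := order_at_XsubC F_eq0 0.
rewrite polyC0 subr0 => ->; rewrite (order_at_poly F_eq0) ?polyX_eq0 //.
by rewrite mupNroot // rootX oner_eq0.
Qed.

Lemma curve_map_curve_section : curve_map iota curve_section curve_twist.
Proof.
split=> [|v vP].
  rewrite (_ : [set _ | _] = R :|: set0); last first.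
    by apply/setP=> r; rewrite !inE curve_section_eq0 orbF.
  by apply: conesPR; rewrite proper0; apply/set0Pn; exists r0.
split=> [|r|].
- under eq_bigr do rewrite -scalerA scalerBl.
  rewrite -scaler_sumr sumrB [X in _ *: X](_ : _ = 0) ?scaler0 //.
  apply/eqP; rewrite subr_eq0; apply/eqP.
  transitivity (\sum_(r in P) gen r).
    rewrite [RHS]big_mkcond; apply: eq_bigr => r _.
    by case: (r \in P); rewrite ?scale1r ?scale0r.
  rewrite relPR big_mkcond; apply: eq_bigr => r _.
  by case: (r \in R); rewrite ?mul1r // mul0r scale0r.
- by rewrite curve_section_eq0 => rR; rewrite curve_vanishing // ler0n.
- rewrite (_ : [set _ | _] =
      R :|: [set r in P | v == order_at F (zero_of r)]); last first.
    apply/setP=> r; rewrite !inE curve_section_eq0.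
    by case: (boolP (r \in R)) => //= rR; rewrite curve_vanishing // ltr0n lt0b.
  apply: conesPR; rewrite properE; apply/andP; split.
    by apply/subsetP=> r; rewrite inE => /andP[].
  apply/negP=> /subsetP sP.
  move: (sP _ r0P) (sP _ r1P); rewrite !inE /zero_of eqxx r10 => /andP[_ /eqP ->].
  by rewrite (negPf order_at_01) andbF.
Qed.

(** A divisor D' in the class of D that avoids the curve has coefficient 0 on R,
    and degree the sum of its coefficients on P, since each section of P outside
    R has one simple zero. Subtracting the terms of R, which are 0, gives an expression
    that depends only on the class: a character contributes its pairing with the
    relation. *)
Lemma intersection_number_curve (D : divisor X) z :
  intersection_number iota D curve_section curve_twist z ->
  z = \sum_(r in P) D r - \sum_(r in R) c r * D r.
Proof.
case=> D' [[u ED'] D'R ->].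
have D'R0 r : r \in R -> D' r = 0.
  by move=> rR; apply: D'R; apply/eqP; rewrite curve_section_eq0.
have -> : \sum_(v \in (place iota : set (K -> int)))
    \sum_(r | curve_section r != 0)
      D' r * (v (curve_section r) + curve_twist v r) = \sum_(r in P) D' r.
  transitivity (\sum_(v \in (place iota : set (K -> int)))
      \sum_(r in P) D' r * (v == order_at F (zero_of r))%:R).
    apply: eq_fsbigr => v /set_mem vP.
    rewrite (big_mkcond (fun r => _ != 0)) [RHS]big_mkcond.
    apply: eq_bigr => r _; rewrite curve_section_eq0.
    case: (boolP (r \in R)) => [rR|rR] /=.
      by case: ifP => // _; rewrite D'R0 ?mul0r.
    by rewrite curve_vanishing //; case: (r \in P) => //=; rewrite mulr0.
  by apply: fsum_indicator => r; exact: place_order_at.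
have ED r : D' r = D r + pairing u (gen r) by rewrite ED' !ffunE.
have R0 : \sum_(r in R) c r * D' r = 0.
  by apply: big1 => r rR; rewrite D'R0 ?mulr0.
transitivity (\sum_(r in P) D' r - \sum_(r in R) c r * D' r).
  by rewrite R0 subr0.
under eq_bigr do rewrite ED; under [X in _ - X = _]eq_bigr do rewrite ED mulrDr.
rewrite !big_split /= opprD addrACA -[RHS]addr0; congr (_ + _).
rewrite -(pairing_sum _ _ c) -relPR.
under [X in _ - pairing _ X]eq_bigr do rewrite -[gen _]scale1r.
rewrite (pairing_sum _ _ (fun=> 1)).
by under [X in _ - X]eq_bigr do rewrite mul1r; rewrite subrr.
Qed.

End RationalCurve.

Lemma fraction_field_frac (A : idomainType) (f : {fraction A}) :
  exists p q : A, q != 0 /\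
    f = FracField.tofrac p / FracField.tofrac q.
Proof.
elim/quotW: f => r; exists (\n_r), (\d_r).
have d0 := denom_ratioP r; split=> //.
apply: (@mulIf _ (FracField.tofrac \d_r)); first by rewrite tofrac_eq0.
rewrite divfK ?tofrac_eq0 // -[LHS]/(FracField.mul _ _) !piE.
apply/eqmodP; rewrite /= FracField.equivfE /FracField.mulf.
by rewrite !numden_Ratio ?mulf_neq0 ?oner_eq0 // !mulr1 mulrC.
Qed.

(** For a primitive relation, P is the left-hand side and R the support of the
    right-hand side. The condition on cones lets the coordinates of R vanish
    identically while those of P vanish in turn, so that the relation is the
    class of a curve. *)
Lemma nef_ray_relation (k : closedFieldType) d (X : fan_data d)
    (P R : {set ray X}) (c : ray X -> int) (D : divisor X) :
  (1 < #|P|)%N ->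
  \sum_(r in P) gen r = \sum_(r in R) c r *: gen r ->
  (forall S : {set ray X}, S \proper P -> R :|: S \in cones X) ->
  nef k D -> \sum_(r in R) c r * D r <= \sum_(r in P) D r.
Proof.
move=> /card_gt1P[r0 [r1 [r0P r1P r01]]] relPR conesPR nefD.
pose F : {rmorphism {poly k} -> {fraction {poly k}}} := @FracField.tofrac {poly k}.
have F_eq0 p : (F p == 0) = (p == 0) by exact: tofrac_eq0.
have F_frac f : exists p q, q != 0 /\ f = F p / F q.
  exact: fraction_field_frac.
rewrite eq_sym in r01.
have [z zE z0] := nefD _ _ (ratfun_function_field F_eq0 F_frac) _ _
  (curve_map_curve_section F_eq0 F_frac relPR conesPR r0P r1P r01).
rewrite -subr_ge0.
by rewrite -(intersection_number_curve F_eq0 F_frac relPR zE).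
Qed.

(** * Base point free divisors are nef *)

(** If D' avoids the rays whose coordinates vanish identically on the curve, then
    its pullback is effective, since the other coordinates are nonzero sections
    with nonnegative orders of vanishing. *)
Lemma base_point_free_nef (k : closedFieldType) d (X : fan_data d)
    (D : divisor X) :
  (forall C, C \in cones X -> exists D' : divisor X,
     [/\ lin_equiv D D', forall r, 0 <= D' r & forall r, r \in C -> D' r = 0]) ->
  nef k D.
Proof.
move=> bpf K iota _ x e [xC xe]; have [D' [DD' D'ge0 D'C]] := bpf _ xC.
exists (\sum_(v \in (place iota : set (K -> int)))
          \sum_(r | x r != 0) D' r * (v (x r) + e v r)).
  by exists D'; split=> // r xr; apply: D'C; rewrite inE xr.
apply: fsumr_ge0 => v /xe[_ xv _]; apply: sumr_ge0 => r xr.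
by rewrite mulr_ge0 // xv.
Qed.

(** * Choosing subsets of given size and integers of given sum *)

Lemma subset_of_card_between (T : finType) (S U : {set T}) c :
  S \subset U -> (#|S| <= c <= #|U|)%N ->
  exists I : {set T}, [/\ S \subset I, I \subset U & #|I| = c].
Proof.
move=> SU /andP[Sc cU]; move: {2}(c - #|S|)%N (erefl (c - #|S|)%N) => h.
elim: h S SU Sc => [|h IH] S SU Sc hE.
  by exists S; split=> //; apply/eqP; rewrite eqn_leq Sc -subn_eq0 hE.
have ltS : (#|S| < #|U|)%N by rewrite (leq_trans _ cU) // -subn_gt0 hE.
have /properP[_ [x xU xS]] : S \proper U by rewrite properEcard SU.
have [|||I [SI IU Ic]] := IH (x |: S) _ _ _.
- by rewrite subUset sub1set xU.
- by rewrite cardsU1 xS add1n -subn_gt0 hE.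
- by rewrite cardsU1 xS add1n subnS hE.
by exists I; split=> //; apply: subset_trans SI; exact: subsetUr.
Qed.

(** A discrete intermediate value property: going from l to u by raising one
    entry by one at a time, the sum takes all the values in between. *)
Lemma sum_int_between (I : finType) (l u : I -> int) (A : int) :
  (forall i, l i <= u i) -> \sum_i l i <= A -> A <= \sum_i u i ->
  exists2 a : I -> int, forall i, l i <= a i <= u i & \sum_i a i = A.
Proof.
move=> lu lA Au.
have [h hE] : exists h : nat, A = \sum_i l i + h%:Z.
  exists (absz (A - \sum_i l i)%R).
  by rewrite gez0_abs ?subr_ge0 // addrC subrK.
elim: h l lu {lA} hE => [|h IH] l lu hE.
  by exists l => [i|]; [rewrite lexx lu | rewrite hE addr0].
have [/existsP[i li]|/existsPn ul] := boolP [exists i, (l i < u i)%R].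
  pose l' j := l j + (j == i)%:R.
  have l'E : \sum_j l' j = \sum_j l j + 1.
    rewrite big_split /=; congr (_ + _); rewrite (bigD1 i) //= eqxx big1 ?addr0 //.
    by move=> j /negPf ->.
  have [j||a la aA] := IH l'.
  - by rewrite /l'; case: eqP => [->|_]; [move: li; lia | rewrite addr0].
  - by rewrite l'E hE; lia.
  by exists a => // j; move: (la j); rewrite /l'; case: (j == i); lia.
have : \sum_i u i <= \sum_i l i by apply: ler_sum => i _; rewrite leNgt.
by move: hE; lia.
Qed.

(** * The fan of the models *)

Section Model.
Variables (m eps n : nat).
Hypothesis m_gt0 : (0 < m)%N.
Hypothesis m_lt_n : (m < n)%N.
Hypothesis n_le : (n <= (2 * m + eps).+1)%N.
Local Notation d := (2 * m + eps)%N.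
Local Notation X := (Z m eps n).
Local Notation xi := (@xidx m eps n).
Implicit Types (I J : {set 'I_n}) (C : {set ray X}) (D : divisor X).

Lemma xidx_inj : injective xi.
Proof.
move=> i j /(congr1 val); rewrite /= !inordK.
- exact: val_inj.
- exact: leq_trans (ltn_ord _) n_le.
- exact: leq_trans (ltn_ord _) n_le.
Qed.

Definition xs_of (A : {set 'I_d.+1}) : {set ray X} :=
  inl @: A : {set 'I_d.+1 + 'I_n}.
Definition ys_of I : {set ray X} := inr @: I : {set 'I_d.+1 + 'I_n}.
Definition pair_of i : {set ray X} := [set inl (xi i); inr i].

Lemma ZprimP (P : {set ray X}) :
  reflect [\/ exists i, P = pair_of i,
              exists2 I : {set 'I_n}, #|I| = m & P = xs_of (~: (xi @: I))
            | exists2 J : {set 'I_n}, #|J| = m.+1 & P = ys_of J] (P \in Zprim m eps n).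
Proof.
rewrite !inE -orbA; apply: (iffP or3P).
  case=> /imsetP[I]; first by move=> _ ->; constructor 1; exists I.
    by rewrite inE => /eqP cI ->; constructor 2; exists I.
  by rewrite inE => /eqP cI ->; constructor 3; exists I.
case=> [[i ->]|[I cI ->]|[J cJ ->]].
- by constructor 1; apply/imsetP; exists i.
- by constructor 2; apply/imsetP; exists I; rewrite ?inE ?cI.
- by constructor 3; apply/imsetP; exists J; rewrite ?inE ?cJ.
Qed.

Lemma mem_xs A j : ((inl j : ray X) \in xs_of A) = (j \in A).
Proof. by apply: mem_imset => ? ? []. Qed.
Lemma mem_ys I i : ((inr i : ray X) \in ys_of I) = (i \in I).
Proof. by apply: mem_imset => ? ? []. Qed.
Lemma xs_ysF A i : ((inr i : ray X) \in xs_of A) = false.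
Proof. by apply/imsetP=> -[]. Qed.
Lemma ys_xsF I j : ((inl j : ray X) \in ys_of I) = false.
Proof. by apply/imsetP=> -[]. Qed.

Lemma coneZP C : reflect
  [/\ forall i, ~ (inl (xi i) \in C /\ inr i \in C),
      forall I, #|I| = m -> ~ (xs_of (~: (xi @: I)) \subset C)
    & forall J, #|J| = m.+1 -> ~ (ys_of J \subset C)] (C \in cones X).
Proof.
rewrite inE; apply: (iffP forall_inP) => [nC|[nC1 nC2 nC3] P /ZprimP].
  split=> [i [xC yC]|I cI|J cJ].
  - have /nC/negP : pair_of i \in Zprim m eps n by apply/ZprimP; constructor 1; exists i.
    by apply; rewrite /pair_of subUset !sub1set xC.
  - by apply/negP/nC/ZprimP; constructor 2; exists I.
  - by apply/negP/nC/ZprimP; constructor 3; exists J.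
case=> [[i ->]|[I cI ->]|[J cJ ->]]; apply/negP.
- move=> /subsetP sC; apply: (nC1 i).
  by split; apply: sC; rewrite !inE eqxx ?orbT.
- exact: nC2.
- exact: nC3.
Qed.

(** * The inequalities imply nefness *)

Definition nef_ineqs (q : 'rV[int]_n) (A : int) : Prop :=
  [/\ forall i, 0 <= q 0 i,
      forall I, #|I| = m -> \sum_(i in I) q 0 i <= A
    & forall J, #|J| = m.+1 -> A <= \sum_(j in J) q 0 j].

(** An effective divisor in the class (q; A) has coefficients a_j on the x_j and
    q_i - a_i on the y_i, where the a_j have sum A, are nonnegative, and satisfy
    a_i <= q_i for i among the first n indices. It avoids C if moreover a_j = 0
    for x_j in C and a_i = q_i for y_i in C. So each a_j ranges in an interval
    [l j, u j]. The sum of the l j is the sum of the q_i over S, a set of at most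
    m indices as no m + 1 of the y's span a cone; since the q_i are nonnegative,
    it is at most A. There is no upper bound if some x_j outside C is not
    opposite to a y; otherwise the sum of the u j is the sum of the q_i over W,
    which has more than m elements because the set of the x's in C contains no
    complement of m indices among the first n. *)
Lemma effective_off_cone (q : 'rV[int]_n) (A : int) C :
  nef_ineqs q A -> C \in cones X ->
  exists D' : divisor X, [/\ coords D' = (q, A), forall r, 0 <= D' r
                           & forall r, r \in C -> D' r = 0].
Proof.
case=> q0 qA Aq /coneZP[C1 C2 C3].
pose S := [set i | (inr i : ray X) \in C].
pose W := [set i | (inl (xi i) : ray X) \notin C].
(* For such j, the only constraint is 0 <= a_j; the bound |A| on a_j still lets
   the sum reach A. *)
pose free (j : 'I_d.+1) := (j \notin xi @: [set: 'I_n]) && ((inl j : ray X) \notin C).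
have SW i : i \in S -> i \in W.
  by rewrite !inE => yC; apply/negP=> xC; apply: (C1 i).
pose l j := \sum_(i in S | xi i == j) q 0 i.
pose u j := \sum_(i in W | xi i == j) q 0 i + (if free j then `|A| else 0).
have mn : (m <= #|[set: 'I_n]|)%N by rewrite cardsT card_ord ltnW.
have lu j : l j <= u j.
  apply: ler_wpDr; first by case: ifP.
  rewrite /l /u [leLHS]big_mkcond [leRHS]big_mkcond; apply: ler_sum => i _.
  by case: (boolP (i \in S)) => [/SW -> //|_] /=; case: ifP.
have lA : \sum_j l j <= A.
  rewrite -(partition_big xi xpredT) //=.
  have cS : (#|S| <= m <= #|[set: 'I_n]|)%N.
    rewrite mn andbT leqNgt; apply/negP=> cS.
    have [||J [_ JS cJ]] := @subset_of_card_between _ set0 S m.+1.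
    - exact: sub0set.
    - by rewrite cards0.
    apply: (C3 J cJ); apply/subsetP=> _ /imsetP[i iJ ->].
    by have := subsetP JS i iJ; rewrite inE.
  have [I [SI _ cI]] := subset_of_card_between (subsetT S) cS.
  apply: le_trans (qA I cI); rewrite [leRHS](big_setID S) /=.
  by rewrite (setIidPr SI) lerDl sumr_ge0.
have Au : A <= \sum_j u j.
  rewrite big_split /= -(partition_big xi xpredT) //=.
  have sf0 : 0 <= \sum_j (if free j then `|A| else 0).
    by apply: sumr_ge0 => j _; case: ifP.
  have [/existsP[j fj]|/existsPn nfree] := boolP [exists j, free j].
    rewrite ler_wpDl ?sumr_ge0 // (bigD1 j) //= fj.
    by rewrite (le_trans (ler_norm A)) // lerDl sumr_ge0 // => i _; case: ifP.
  rewrite ler_wpDr //; have cW : (m < #|W|)%N.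
    rewrite ltnNge; apply/negP=> cW.
    have [|I [WI _ cI]] := subset_of_card_between (subsetT W) (c := m).
      by rewrite cW.
    apply: (C2 I cI); apply/subsetP=> _ /imsetP[j jI ->].
    apply: contraNT (nfree j) => jC; rewrite /free jC andbT.
    apply: contraTN jI => /imsetP[i _ ji]; rewrite inE negbK ji imset_f //.
    by apply: (subsetP WI); rewrite inE -ji.
  have [||J [_ JW cJ]] := @subset_of_card_between _ set0 W m.+1.
  - exact: sub0set.
  - by rewrite cards0.
  apply: le_trans (Aq J cJ) _; rewrite [leRHS](big_setID J) /=.
  by rewrite (setIidPr JW) lerDl sumr_ge0.
have [a la aA] := sum_int_between lu lA Au.
have a0 j : 0 <= a j.
  by have /andP[+ _] := la j; apply: le_trans; apply: sumr_ge0.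
have aq i : a (xi i) <= q 0 i.
  have /andP[_] := la (xi i); move/le_trans; apply.
  have -> : u (xi i) = \sum_(i' in W | xi i' == xi i) q 0 i'.
    by rewrite /u /free imset_f ?addr0.
  under eq_bigl do rewrite (inj_eq xidx_inj).
  rewrite big_mkcondl big_pred1_eq.
  by case: ifP.
have aS i : i \in S -> a (xi i) = q 0 i.
  move=> iS; apply: le_anti; rewrite aq; have /andP[+ _] := la (xi i).
  apply: le_trans; rewrite /l (bigD1 i) /= ?iS ?eqxx // lerDl.
  by apply: sumr_ge0.
exists [ffun r : 'I_d.+1 + 'I_n =>
  match r with inl j => a j | inr i => q 0 i - a (xi i) end].
split=> [|[j|i]|[j|i]].
- congr pair; first by apply/rowP=> i; rewrite !mxE !ffunE addrC subrK.
  by rewrite -aA; apply: eq_bigr => j _; rewrite ffunE.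
- by rewrite ffunE.
- by rewrite ffunE subr_ge0.
- move=> jC; rewrite ffunE; apply: le_anti; rewrite a0 andbT.
  have /andP[_] := la j; move/le_trans; apply.
  rewrite /u /free jC andbF addr0 big1 // => i /andP[].
  by rewrite inE => iW /eqP ij; rewrite ij jC in iW.
- by move=> iC; rewrite ffunE aS ?subrr // inE.
Qed.

(** * Nefness implies the inequalities *)

Lemma sum_xs A (V : nmodType) (f : ray X -> V) :
  \sum_(r in xs_of A) f r = \sum_(j in A) f (inl j).
Proof. by rewrite big_imset //= => ? ? _ _ []. Qed.

Lemma sum_ys I (V : nmodType) (f : ray X -> V) :
  \sum_(r in ys_of I) f r = \sum_(i in I) f (inr i).
Proof. by rewrite big_imset //= => ? ? _ _ []. Qed.

Lemma sum_xidx_compl I (V : zmodType) (f : 'I_d.+1 -> V) :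
  \sum_(j in ~: (xi @: I)) f j = \sum_j f j - \sum_(i in I) f (xi i).
Proof.
rewrite (bigID (mem (xi @: I)) xpredT) /= big_imset; last first.
  by move=> ? ? _ _; exact: xidx_inj.
by rewrite addrAC subrr add0r; apply: eq_bigl => j; rewrite inE.
Qed.

(** For m indices this is the second primitive relation; for m + 1 indices, read
    from right to left, it is the third. *)
Lemma sum_gen_x_compl I :
  \sum_(j in ~: (xi @: I)) gen (inl j : ray X) =
  \sum_(i in I) gen (inr i : ray X).
Proof. by rewrite sum_xidx_compl sum_xvec sub0r -sumrN. Qed.

Lemma proper_Zprim_nsub (P Q S : {set ray X}) : P \in Zprim m eps n ->
  Q \in Zprim m eps n -> S \proper P -> ~~ (Q \subset S).
Proof.
move=> hP hQ SP; apply/negP=> QS.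
have := Zprim_antichain m_gt0 n_le hQ hP.
by rewrite (sub_proper_trans QS SP).
Qed.

Lemma nef_q_ge0 (k : closedFieldType) D i : nef k D ->
  0 <= D (inl (xi i)) + D (inr i).
Proof.
have PZ : pair_of i \in Zprim m eps n by apply/ZprimP; constructor 1; exists i.
have sumP (V : nmodType) (f : ray X -> V) :
    \sum_(r in pair_of i) f r = f (inl (xi i)) + f (inr i).
  rewrite /pair_of big_setU1 /=; last by rewrite inE.
  by rewrite big_set1.
move/(@nef_ray_relation k d X (pair_of i) set0 (fun=> 1)).
rewrite !big_set0 !sumP; apply.
- exact: Zprim_card PZ.
- by rewrite /= subrr.
- move=> S SP; rewrite set0U inE; apply/forall_inP=> Q hQ.
  exact: proper_Zprim_nsub SP.
Qed.

(** A primitive collection contained in the union of the m y's on the right-hand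
    side and of a proper part of the x's on the left-hand side cannot be a pair
    x_i, y_i, as the two sides have disjoint sets of indices, nor a set of
    m + 1 of the y's; a set of x's would be strictly contained in the left-hand
    side, which is itself a primitive collection. *)
Lemma nef_le_A (k : closedFieldType) D I : nef k D -> #|I| = m ->
  \sum_(i in I) (D (inl (xi i)) + D (inr i)) <= \sum_j D (inl j).
Proof.
move=> nD cI.
have PZ : xs_of (~: (xi @: I)) \in Zprim m eps n.
  by apply/ZprimP; constructor 2; exists I.
suff: \sum_(r in ys_of I) 1 * D r <= \sum_(r in xs_of (~: (xi @: I))) D r.
  under eq_bigr do rewrite mul1r.
  by rewrite sum_xs sum_ys sum_xidx_compl lerBrDl big_split.
apply: (nef_ray_relation (c := fun=> 1) _ _ _ nD).
- exact: Zprim_card PZ.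
- rewrite sum_xs sum_ys sum_gen_x_compl.
  by apply: eq_bigr => i _; rewrite scale1r.
move=> S SP; have /subsetP sSP := proper_sub SP; apply/coneZP; split=> [i|I' cI'|J cJ].
- rewrite !inE mem_ys ys_xsF /= => -[xS /orP[iI|/sSP]]; last by rewrite xs_ysF.
  by have := sSP _ xS; rewrite mem_xs inE imset_f.
- move=> /subsetP sQ.
  suff : xs_of (~: (xi @: I')) \subset S.
    by apply/negP/(proper_Zprim_nsub PZ) => //; apply/ZprimP; constructor 2; exists I'.
  apply/subsetP=> r rQ; have := sQ r rQ; rewrite inE.
  by case: r rQ => [j|i]; rewrite ?xs_ysF // ys_xsF.
- move=> /subsetP sQ.
  suff /subset_leq_card : J \subset I by rewrite cI cJ ltnn.
  apply/subsetP=> i iJ; have := sQ (inr i); rewrite mem_ys iJ inE mem_ys.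
  by move=> /(_ isT)/orP[//|/sSP]; rewrite xs_ysF.
Qed.

(** The same argument with the roles of the x's and the y's exchanged: the
    right-hand side misses m + 1 of the x's, so that it contains no complement
    of m of them. *)
Lemma nef_A_le (k : closedFieldType) D J : nef k D -> #|J| = m.+1 ->
  \sum_j D (inl j) <= \sum_(i in J) (D (inl (xi i)) + D (inr i)).
Proof.
move=> nD cJ.
have PZ : ys_of J \in Zprim m eps n by apply/ZprimP; constructor 3; exists J.
suff: \sum_(r in xs_of (~: (xi @: J))) 1 * D r <= \sum_(r in ys_of J) D r.
  under eq_bigr do rewrite mul1r.
  by rewrite sum_xs sum_ys sum_xidx_compl lerBlDl big_split.
apply: (nef_ray_relation (c := fun=> 1) _ _ _ nD).
- exact: Zprim_card PZ.
- rewrite sum_xs sum_ys -sum_gen_x_compl.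
  by apply: eq_bigr => j _; rewrite scale1r.
move=> S SP; have /subsetP sSP := proper_sub SP; apply/coneZP; split=> [i|I cI|J' cJ'].
- rewrite !inE mem_xs xs_ysF /= => -[/orP[|/sSP]]; last by rewrite ys_xsF.
  by rewrite inE => + /sSP; rewrite mem_ys => /negP + iJ; apply; rewrite imset_f.
- move=> /subsetP sQ.
  suff /subset_leq_card : xi @: J \subset xi @: I.
    by rewrite !card_imset ?cI ?cJ ?ltnn //; exact: xidx_inj.
  rewrite -setCS; apply/subsetP=> j jI.
  have := sQ (inl j); rewrite mem_xs jI inE mem_xs.
  by move=> /(_ isT)/orP[//|/sSP]; rewrite ys_xsF.
- move=> /subsetP sQ.
  suff : ys_of J' \subset S.
    by apply/negP/(proper_Zprim_nsub PZ) => //; apply/ZprimP; constructor 3; exists J'.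
  apply/subsetP=> r rQ; have := sQ r rQ; rewrite inE.
  by case: r rQ => [j|i]; rewrite ?ys_xsF // xs_ysF.
Qed.

Lemma nefZE (k : closedFieldType) D q A :
  coords D = (q, A) -> nef k D <-> nef_ineqs q A.
Proof.
move=> DqA; split=> [nD|qA].
  case: DqA => <- <-; split=> [i|I cI|J cJ].
  - by rewrite mxE; exact: nef_q_ge0 nD.
  - apply: le_trans (nef_le_A nD cI).
    by apply: ler_sum => i _; rewrite mxE.
  - apply: le_trans (nef_A_le nD cJ) _.
    by apply: ler_sum => j _; rewrite mxE.
apply: base_point_free_nef => C CX.
have [D' [D'qA D'0 D'C]] := effective_off_cone qA CX.
by exists D'; split=> //; apply/coords_eq; rewrite DqA.
Qed.

Lemma coords_anticanonical :
  coords (- canonical_divisor X) = (const_mx 2, d.+1%:Z).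
Proof.
congr pair; first by apply/rowP=> i; rewrite !mxE !ffunE opprK.
rewrite /= (eq_bigr (fun=> 1)) => [|j _]; last by rewrite !ffunE opprK.
by rewrite sumr_const card_ord natz.
Qed.

End Model.

(** * The nef cone and the anticanonical class *)

Theorem lemma5p3 (k : closedFieldType) :
  (forall m eps n : nat,
     (1 <= m)%N -> (eps <= 1)%N -> (3 <= 2 * m + eps)%N ->
     (m + 1 <= n <= 2 * m + eps + 1)%N ->
     (forall (q : 'rV[int]_n) (A : int) (D : divisor (Z m eps n)),
        coords D = (q, A) ->
        (nef k D <->
         [/\ forall i : 'I_n, 0 <= q 0 i,
             forall I : {set 'I_n}, #|I| = m -> \sum_(i in I) q 0 i <= A
           & forall J : {set 'I_n}, #|J| = (m + 1)%N -> A <= \sum_(j in J) q 0 j])) /\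
     coords (- canonical_divisor (Z m eps n))
       = (const_mx 2, (2 * m + eps + 1)%N%:Z)) /\
  (forall m n : nat,
     (2 <= m)%N -> (m + 1 <= n <= 2 * m + 1)%N ->
     nef_semigroup m 0 n k = nef_semigroup m 1 n k /\
     coords (- canonical_divisor (Z m 0 n))
       <> coords (- canonical_divisor (Z m 1 n))).
Proof.
split=> [m eps n m0 _ _ /andP[]|m n m2 /andP[]].
  rewrite !addn1 => mn nd; split; last exact: coords_anticanonical.
  by move=> q A D; exact: nefZE.
rewrite !addn1 => mn nd; have m0 : (0 < m)%N by apply: leq_trans m2.
have nefE eps : (n <= (2 * m + eps).+1)%N ->
    nef_semigroup m eps n k = [set c | nef_ineqs m c.1 c.2]%classic.
  move=> nd'; apply/seteqP; split=> [_ [D nD <-]|[q A] qA] /=.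
    exact: (nefZE m0 mn nd' k (surjective_pairing (coords D))).1 nD.
  have [D DE] := coords_surj m eps (q, A).
  by exists D => //; apply/(nefZE m0 mn nd' k DE).
split; first by rewrite !nefE //; lia.
by rewrite !coords_anticanonical => -[]; lia.
Qed.
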